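(* Let $(\Omega,\mathcal{A},\mu)$ be a $\sigma$-finite measure space, let $X$ be a Banach function space on $\Omega$, and let $\Phi_1,\Phi_2$ be two strictly increasing continuous Young functions. Suppose there exists a set $E\in\mathcal{A}$ with $\chi_E\in X$ and $\mu(E)>0$ which is diffuse for $X$. If $\Phi_1\nprec\Phi_2$, then $X^{\Phi_2}\setminus X^{\Phi_1}$ is spaceable in $X^{\Phi_2}$.
   Context: $\mathcal{M}_0(\Omega)$ denotes the set of all $\mathcal{A}$-measurable complex-valued functions on $\Omega$, with functions that are equal $\mu$-almost everywhere identified. A linear subspace $X$ of $\mathcal{M}_0(\Omega)$ equipped with a norm $\|\cdot\|_X$ is called a Banach function space on $\Omega$ if $(X,\|\cdot\|_X)$ is a Banach space. $\chi_E$ is the characteristic function of $E$. A convex function $\Phi:[0,\infty)\to[0,\infty)$ is a Young function if $\Phi(0)=\lim_{x\to0}\Phi(x)=0$ and $\lim_{x\to\infty}\Phi(x)=\infty$. For $f\in\mathcal{M}_0(\Omega)$ put $\|f\|_\Phi:=\inf\{\lambda>0:\ \Phi(|f|/\lambda)\in X,\ \|\Phi(|f|/\lambda)\|_X\leq1\}$ (with $\inf\varnothing=\infty$); $X^\Phi$ is the set of all $f\in\mathcal{M}_0(\Omega)$ with $\|f\|_\Phi<\infty$, equipped with $\|\cdot\|_\Phi$, with which it is taken to be a Banach function space on $\Omega$. A set $E\in\mathcal{A}$ is called diffuse for $X$ if $\chi_E\in X$ and for each $Y\in\mathcal{A}$ with $Y\subseteq E$ and each $0\leq\alpha\leq\|\chi_Y\|_X$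 there exists $F\in\mathcal{A}$ with $F\subseteq Y$ and $\|\chi_F\|_X=\alpha$. $\Phi_1\prec\Phi_2$ (''$\Phi_2$ is stronger than $\Phi_1$'') means that there exist $a>0$ and $x_0\geq0$ such that $\Phi_1(x)\leq\Phi_2(ax)$ for all $x\geq x_0$; $\Phi_1\nprec\Phi_2$ is its negation. A subset $S$ of a Banach space $Y$ is called spaceable in $Y$ if $S\cup\{0\}$ contains a closed infinite-dimensional linear subspace of $Y$. *)

(* Defs.v *)
From HB Require Import structures.
From mathcomp Require Import all_boot all_order all_algebra.
From mathcomp Require Import generic_quotient ring_quotient.
From mathcomp Require Import all_classical all_reals all_analysis measurable_realfun.
From mathcomp Require Import complex.

Set Implicit Arguments.
Unset Strict Implicit.
Unset Printing Implicit Defensive.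

Import Order.TTheory GRing.Theory Num.Theory.
Import numFieldNormedType.Exports.
Import ComplexField.Normc.

Local Open Scope classical_set_scope.
Local Open Scope ring_scope.
Local Open Scope complex_scope.
Local Open Scope quotient_scope.

Section MeasurableComplexFunctions.
Context d (T : measurableType d) (R : realType).

(* [R[i]^o] is [R[i]] seen as a vector space over itself, so that [T -> R[i]^o]
   is the complex vector space of all functions. *)
Definition cmeas : {pred T -> R[i]^o} :=
  mem [set f : T -> R[i]^o | measurable_fun setT (fun t => complex.Re (f t)) /\
                             measurable_fun setT (fun t => complex.Im (f t))].

Lemma cmeas_submod_closed : submod_closed cmeas.
Proof.
split.
  by rewrite inE; split; exact: measurable_cst.
move=> [a b] f g; rewrite !inE => -[fr fi] [gr gi].
have eR : (fun t => complex.Re (((a +i* b) *: f + g) t)) =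
    (fun t => a * complex.Re (f t) - b * complex.Im (f t)
              + complex.Re (g t)).
  by apply/funext => t; rewrite !fctE; case: (f t) (g t) => [? ?] [? ?].
have eI : (fun t => complex.Im (((a +i* b) *: f + g) t)) =
    (fun t => a * complex.Im (f t) + b * complex.Re (f t)
              + complex.Im (g t)).
  by apply/funext => t; rewrite !fctE; case: (f t) (g t) => [? ?] [? ?].
split; rewrite ?eR ?eI; apply: measurable_funD => //.
  by apply: measurable_funB; apply: measurable_funM.
by apply: measurable_funD; apply: measurable_funM.
Qed.

HB.instance Definition _ :=
  GRing.isSubmodClosed.Build R[i] (T -> R[i]^o) cmeas cmeas_submod_closed.

Record cmfun := CMFun { cmfun_val :> T -> R[i]^o ; _ : cmfun_val \in cmeas }.

HB.instance Definition _ := [isSub for cmfun_val].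
HB.instance Definition _ := [Choice of cmfun by <:].
HB.instance Definition _ := [SubChoice_isSubLmodule of cmfun by <:].

End MeasurableComplexFunctions.

Section M0.
Context d (T : measurableType d) (R : realType) (mu : {measure set T -> \bar R}).

Definition nullfun : {pred cmfun T R} :=
  mem [set f : cmfun T R | (f : T -> R[i]) = cst 0 %[ae mu]].

Lemma nullfun_submod_closed : submod_closed nullfun.
Proof.
split.
  by rewrite inE; exact: aeW.
move=> a f g; rewrite !inE => f0 g0.
apply: filterS2 f0 g0 => t /= f0 g0 _.
by rewrite !fctE f0// g0// addr0 scaler0.
Qed.

HB.instance Definition _ :=
  GRing.isSubmodClosed.Build R[i] (cmfun T R) nullfun nullfun_submod_closed.

Definition M0 : Type := Quotient.quot nullfun.
HB.instance Definition _ := EqQuotient.on M0.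
HB.instance Definition _ := GRing.Zmodule.on M0.

Lemma pi_M0P (f g : cmfun T R) :
  \pi_M0 f = \pi_M0 g <-> (f : T -> R[i]) = g %[ae mu].
Proof.
have -> : (\pi_M0 f = \pi_M0 g) <-> (f - g \in nullfun).
  by rewrite Quotient.idealrBE; split => /eqP.
rewrite inE; split; apply: filterS => t /= + _ => /(_ Logic.I).
  by rewrite !fctE => /eqP; rewrite subr_eq0 => /eqP.
by rewrite !fctE => ->; rewrite subrr.
Qed.

Definition M0_scale (a : R[i]) (u : M0) : M0 := \pi_M0 (a *: (repr u : cmfun T R)).

Lemma pi_M0_scale a (f : cmfun T R) : M0_scale a (\pi_M0 f) = \pi_M0 (a *: f).
Proof.
apply/pi_M0P; have /pi_M0P := reprK (\pi_M0 f).
by apply: filterS => t /= h _; rewrite !fctE h.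
Qed.

Let pi_M0D (f g : cmfun T R) : \pi_M0 (f + g) = \pi_M0 f + \pi_M0 g.
Proof. by rewrite !piE. Qed.

Let M0_scalerA a b u : M0_scale a (M0_scale b u) = M0_scale (a * b) u.
Proof. by elim/quotW: u => f; rewrite [M0_scale b _]pi_M0_scale !pi_M0_scale scalerA. Qed.

Let M0_scale1r : left_id 1 M0_scale.
Proof. by elim/quotW => f; rewrite pi_M0_scale scale1r. Qed.

Let M0_scalerDr : right_distributive M0_scale +%R.
Proof.
move=> a; elim/quotW => f; elim/quotW => g.
by rewrite -pi_M0D !pi_M0_scale -pi_M0D scalerDr.
Qed.

Let M0_scalerDl u : {morph M0_scale^~ u : a b / a + b}.
Proof.
by elim/quotW: u => f a b; rewrite !pi_M0_scale -pi_M0D scalerDl.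
Qed.

HB.instance Definition _ := GRing.Zmodule_isLmodule.Build R[i] M0
  M0_scalerA M0_scale1r M0_scalerDr M0_scalerDl.

Definition M0_fun (u : M0) : T -> R[i] := (repr u : cmfun T R).

(* Class of [g]; the default value 0 is only reached if [g] is not measurable. *)
Definition M0_class (g : T -> R[i]) : M0 := \pi_M0 (insubd (0 : cmfun T R) g).

Lemma M0_classP (g : T -> R[i]) (u : M0) : (g : T -> R[i]^o) \in @cmeas _ T R ->
  M0_class g = u <-> g = M0_fun u %[ae mu].
Proof.
by move=> mg; rewrite -{1}[u]reprK pi_M0P /insubd insubT.
Qed.

End M0.

Section NormedSubspaces.
Context (R : realType) (V : lmodType R[i]).
Implicit Types (X W S : set V) (N : V -> R).

(* A normed space whose underlying space is a linear subspace of [V] is a pair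
   of a carrier [X] and a norm [N]; the values of [N] off [X] are never used. *)
Definition normed_subspace X N : Prop :=
  [/\ submod_closed (mem X),
      forall u, X u -> 0 <= N u,
      forall u, X u -> N u = 0 -> u = 0,
      forall (a : R[i]) u, X u -> N (a *: u) = normc a * N u
    & forall u v, X u -> X v -> N (u + v) <= N u + N v].

Definition complete_subspace X N : Prop :=
  forall u : nat -> V, (forall n, X (u n)) ->
    (forall e : R, 0 < e -> exists n0, forall m n,
       (n0 <= m)%N -> (n0 <= n)%N -> N (u m - u n) < e) ->
    exists2 l, X l & N (u n - l) @[n --> \oo] --> (0 : R).

Definition banach_subspace X N : Prop :=
  normed_subspace X N /\ complete_subspace X N.

Definition closed_in X N W : Prop :=
  forall l, X l -> (forall e : R, 0 < e -> exists2 w, W w & N (w - l) < e) ->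
    W l.

Definition infinite_dimensional W : Prop :=
  ~ exists (n : nat) (b : 'I_n -> V), (forall i, W (b i)) /\
      forall w, W w -> exists c : 'I_n -> R[i], w = \sum_(i < n) c i *: b i.

Definition spaceable X N S : Prop :=
  exists W : set V, [/\ W `<=` S `|` [set 0], W `<=` X, submod_closed (mem W),
                        closed_in X N W & infinite_dimensional W].

End NormedSubspaces.

Section YoungFunctions.
Context (R : realType).
Implicit Types Phi : R -> R.

(* Functions on [0, +oo[ are represented by total functions, of which only the
   values on [0, +oo[ are constrained or used. *)
Definition young_function Phi : Prop :=
  [/\ forall x, 0 <= x -> 0 <= Phi x,
      convex_function (`[0, +oo[%classic : set R) Phi,
      Phi 0 = 0,
      Phi x @[x --> 0^'+] --> (0 : R)
    & Phi x @[x --> +oo] --> +oo].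

Definition strictly_increasing_young Phi : Prop :=
  {in `[0, +oo[ &, {homo Phi : x y / x < y}}.

Definition continuous_young Phi : Prop := {within `[0, +oo[, continuous Phi}.

Definition weaker Phi1 Phi2 : Prop :=
  exists a x0 : R, [/\ 0 < a, 0 <= x0 &
    forall x, x0 <= x -> Phi1 x <= Phi2 (a * x)].

End YoungFunctions.

Section OrliczSpaces.
Context d (T : measurableType d) (R : realType) (mu : {measure set T -> \bar R}).
Implicit Types (X : set (M0 mu)) (N : M0 mu -> R) (Phi : R -> R) (E : set T).

Definition banach_function_space X N : Prop := banach_subspace X N.

Definition chi E : M0 mu := M0_class mu (fun t => (\1_E t : R)%:C).

Definition young_comp Phi (f : M0 mu) (l : R) : M0 mu :=
  M0_class mu (fun t => (Phi (normc (M0_fun f t) / l))%:C).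

Definition luxemburg X N Phi (f : M0 mu) : \bar R :=
  ereal_inf [set l%:E | l in
    [set l : R | [/\ 0 < l, X (young_comp Phi f l) & N (young_comp Phi f l) <= 1]]].

Definition orlicz X N Phi : set (M0 mu) :=
  [set f | (luxemburg X N Phi f < +oo)%E].

Definition orlicz_norm X N Phi (f : M0 mu) : R := fine (luxemburg X N Phi f).

(* ||chi_Y||_X only makes sense for chi_Y in X, hence the guard on [Y]. *)
Definition diffuse X N E : Prop :=
  [/\ measurable E, X (chi E) &
    forall Y, measurable Y -> Y `<=` E -> X (chi Y) ->
    forall alpha : R, 0 <= alpha -> alpha <= N (chi Y) ->
    exists F, [/\ measurable F, F `<=` Y, X (chi F) & N (chi F) = alpha]].

End OrliczSpaces.

(* Main.v *)
Require Import Defs.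
From mathcomp Require Import all_boot all_order all_algebra.
From mathcomp Require Import all_classical all_reals all_analysis.
From mathcomp Require Import generic_quotient measurable_realfun complex.
From mathcomp Require Import ring lra.

(* The norm of [X] need be neither monotone nor related to convergence a.e., but
   [X^Phi] is better behaved: its Luxemburg norm depends only on [|f|], and over
   the complex numbers this forces [X^Phi] to be solid with a monotone norm,
   because any [0 <= a <= |v|] is the midpoint of two functions of modulus
   [|v|]. Hence norm limits in [X^Phi] can be identified pointwise, and sums
   only have to converge in [X^Phi2], never in [X].

   Since [Phi1] is not weaker than [Phi2], there are [x_n] with
   [Phi2 ((n+1) 2^n x_n) < Phi1 x_n]; diffuseness gives disjoint [A_n] with
   [||chi_{A_n}||_X = 1 / Phi2 ((n+1) 2^n x_n)]. Then [(n+1) x_n chi_{A_n}] has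
   norm at most [2^-n] in [X^Phi2] and at least [n+1] in [X^Phi1]. Splitting the
   indices into infinitely many infinite classes and summing over each class
   yields disjointly supported functions whose closed span in [X^Phi2] meets
   [X^Phi1] only in 0. *)

Set Implicit Arguments.
Unset Strict Implicit.
Unset Printing Implicit Defensive.

Import Order.TTheory GRing.Theory Num.Theory.
Import numFieldNormedType.Exports.
Import ComplexField.Normc.
Local Open Scope classical_set_scope.
Local Open Scope ring_scope.

(** * Elementary rules for normed subspaces *)

Section Subspaces.
Context (R : realType) (V : lmodType R[i]).
Implicit Types (X : set V) (N : V -> R).

Lemma submod0 X : submod_closed (mem X) -> X 0.
Proof. by move=> sub; have := sub.1; rewrite inE. Qed.

Lemma submodZ X c x : submod_closed (mem X) -> X x -> X (c *: x).
Proof.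
move=> sub Xx; have := sub.2 c x 0; rewrite !inE addr0; apply => //.
exact: submod0.
Qed.

Lemma submodD X x y : submod_closed (mem X) -> X x -> X y -> X (x + y).
Proof.
by move=> sub Xx Xy; have := sub.2 1 x y; rewrite !inE scale1r; exact.
Qed.

Lemma submodN X x : submod_closed (mem X) -> X x -> X (- x).
Proof. by rewrite -scaleN1r; exact: submodZ. Qed.

Lemma submodB X x y : submod_closed (mem X) -> X x -> X y -> X (x - y).
Proof. by move=> sub Xx Xy; apply: submodD => //; exact: submodN. Qed.

Lemma normed_subspaceN X N x : normed_subspace X N -> X x -> N (- x) = N x.
Proof.
move=> [_ _ _ NZ _] Xx; rewrite -scaleN1r NZ//.
by rewrite normcN normc1 mul1r.
Qed.

Lemma normed_subspace0 X N : normed_subspace X N -> N 0 = 0.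
Proof.
move=> [sub _ _ NZ _]; rewrite -[in LHS](scale0r (0 : V)) NZ ?normc0 ?mul0r//.
exact: submod0.
Qed.

Lemma normed_subspaceB X N x y : normed_subspace X N -> X x -> X y ->
  N (x - y) <= N x + N y.
Proof.
move=> nX Xx Xy; rewrite -(normed_subspaceN nX Xy).
by case: nX => sub _ _ _ ND; apply: ND => //; exact: submodN.
Qed.

Lemma normed_subspace_sub X N x y : normed_subspace X N -> X x -> X y ->
  N (x - y) = N (y - x).
Proof.
move=> nX Xx Xy; rewrite -(normed_subspaceN nX) ?opprB//.
by apply: submodB => //; case: nX.
Qed.

End Subspaces.

(** * Almost-everywhere calculus in the quotient [M0] *)

Section MeasurableClasses.
Local Open Scope complex_scope.
Context d (T : measurableType d) (R : realType) (mu : {measure set T -> \bar R}).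
Implicit Types (f g : T -> R) (u v : M0 mu).

Lemma cmeas_complex f g : measurable_fun setT f -> measurable_fun setT g ->
  (fun t => f t +i* g t) \in @cmeas _ T R.
Proof. by rewrite inE. Qed.

Lemma M0_fun_cmeas u : M0_fun u \in @cmeas _ T R.
Proof. by rewrite /M0_fun; case: (repr u). Qed.

Lemma M0_fun_class (g : T -> R[i]) : g \in @cmeas _ T R ->
  \forall t \ae mu, M0_fun (M0_class mu g) t = g t.
Proof.
move=> mg; have /(M0_classP _ mg) : M0_class mu g = M0_class mu g by [].
by apply: filterS => t /= ->.
Qed.

Lemma M0_ext u v : (\forall t \ae mu, M0_fun u t = M0_fun v t) -> u = v.
Proof.
move=> uv; rewrite -[u]reprK -[v]reprK; apply/pi_M0P.
by apply: filterS uv => t + _.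
Qed.

Lemma M0_class_ext (g h : T -> R[i]) :
  g \in @cmeas _ T R -> h \in @cmeas _ T R -> (\forall t \ae mu, g t = h t) ->
  M0_class mu g = M0_class mu h.
Proof.
move=> mg mh gh; apply/(M0_classP _ mg).
by apply: filterS2 (M0_fun_class mh) gh => t /= -> ->.
Qed.

Lemma M0_funD u v :
  \forall t \ae mu, M0_fun (u + v) t = M0_fun u t + M0_fun v t.
Proof.
have /pi_M0P : \pi_(M0 mu)%qT (repr (u + v)) =
    \pi_(M0 mu)%qT (repr u + repr v).
  rewrite reprK -[in LHS](reprK u) -[in LHS](reprK v).
  by rewrite !piE.
by apply: filterS => t /(_ Logic.I).
Qed.

Lemma M0_funZ a u : \forall t \ae mu, M0_fun (a *: u) t = a * M0_fun u t.
Proof.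
have /pi_M0P : \pi_(M0 mu)%qT (repr (a *: u)) = \pi_(M0 mu)%qT (a *: repr u).
  by rewrite reprK.
by apply: filterS => t /(_ Logic.I).
Qed.

Lemma M0_fun0 : \forall t \ae mu, M0_fun (0 : M0 mu) t = 0.
Proof. by have := M0_funZ 0 0; apply: filterS => t; rewrite scale0r mul0r. Qed.

Lemma M0_funB u v :
  \forall t \ae mu, M0_fun (u - v) t = M0_fun u t - M0_fun v t.
Proof.
have := M0_funZ (-1) v; rewrite scaleN1r.
by apply: filterS2 (M0_funD u (- v)) => t /= -> ->; rewrite mulN1r.
Qed.

Lemma measurable_sqrt : measurable_fun setT (@Num.sqrt R).
Proof. by apply: continuous_measurable_fun; exact: sqrt_continuous. Qed.

Lemma cmeas_Re (g : T -> R[i]) : g \in @cmeas _ T R ->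
  measurable_fun setT (fun t => complex.Re (g t)).
Proof. by rewrite inE => -[]. Qed.

Lemma cmeas_Im (g : T -> R[i]) : g \in @cmeas _ T R ->
  measurable_fun setT (fun t => complex.Im (g t)).
Proof. by rewrite inE => -[]. Qed.

Lemma measurable_normc (g : T -> R[i]) : g \in @cmeas _ T R ->
  measurable_fun setT (fun t => normc (g t)).
Proof.
move=> mg; have -> : (fun t => normc (g t)) =
    Num.sqrt \o (fun t => complex.Re (g t) ^+ 2 + complex.Im (g t) ^+ 2).
  by apply/funext => t /=; case: (g t).
apply: measurableT_comp; first exact: measurable_sqrt.
apply: measurable_funD; apply: measurable_funX.
  exact: cmeas_Re.
exact: cmeas_Im.
Qed.

Lemma cmeas_real f : measurable_fun setT f ->
  (fun t => (f t)%:C) \in @cmeas _ T R.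
Proof. by move=> mf; exact: cmeas_complex. Qed.

Lemma normc_real (x : R) : 0 <= x -> normc (x%:C) = x.
Proof. by move=> x0; rewrite /= expr0n addr0 sqrtr_sqr ger0_norm. Qed.

Lemma normc_ge0 (z : R[i]) : 0 <= normc z.
Proof. by case: z => a b; exact: sqrtr_ge0. Qed.

End MeasurableClasses.

(** * Solidity of Orlicz spaces, and norms of scaled characteristic functions *)

Section OrliczSolid.
Local Open Scope complex_scope.
Context d (T : measurableType d) (R : realType) (mu : {measure set T -> \bar R}).
Implicit Types (X V : set (M0 mu)) (N : M0 mu -> R) (Phi : R -> R) (u v : M0 mu).

Definition solid V N : Prop := forall u v, V v ->
  (\forall t \ae mu, normc (M0_fun u t) <= normc (M0_fun v t)) ->
  V u /\ N u <= N v.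

(** [Phi] is continuous only within [[0, +oo[], so the composition passes through measurability on
    that subspace, which contains the range of [f]. *)
Lemma measurable_young Phi (f : T -> R) : continuous_young Phi ->
  measurable_fun setT f -> (forall t, 0 <= f t) ->
  measurable_fun setT (Phi \o f).
Proof.
move=> cPhi mf f0.
have mPhi : measurable_fun (`[0, +oo[%classic : set R) Phi.
  exact: subspace_continuous_measurable_fun.
apply: (measurable_comp _ _ mPhi mf) => //.
by move=> _ [t _ <-] /=; rewrite in_itv/= f0.
Qed.

Lemma young_comp_cmeas Phi u l : continuous_young Phi -> 0 < l ->
  (fun t => (Phi (normc (M0_fun u t) / l))%:C) \in @cmeas _ T R.
Proof.
move=> cPhi l0; apply: cmeas_real.
apply: (@measurable_young _ (fun t => normc (M0_fun u t) / l)) => //.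
  apply: measurable_funM => //; exact/measurable_normc/M0_fun_cmeas.
by move=> t; rewrite divr_ge0 ?normc_ge0// ltW.
Qed.

Lemma young_comp_normc Phi u v l : continuous_young Phi -> 0 < l ->
  (\forall t \ae mu, normc (M0_fun u t) = normc (M0_fun v t)) ->
  young_comp Phi u l = young_comp Phi v l.
Proof.
move=> cPhi l0 uv; apply: M0_class_ext; try exact: young_comp_cmeas.
by apply: filterS uv => t ->.
Qed.

Lemma luxemburg_normc X N Phi u v : continuous_young Phi ->
  (\forall t \ae mu, normc (M0_fun u t) = normc (M0_fun v t)) ->
  luxemburg X N Phi u = luxemburg X N Phi v.
Proof.
move=> cPhi uv; congr ereal_inf; congr image.
apply/seteqP; split=> l /= [l0].
  by rewrite (@young_comp_normc _ u v).
by rewrite (@young_comp_normc _ u v).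
Qed.

(* [u] enters only through [a = |u|], and [a] is the midpoint of
   [a +i* b] and [a -i* b] with [b = sqrt (|v|^2 - a^2)], both of modulus [|v|]. *)
Lemma orlicz_solid X N Phi : continuous_young Phi ->
  normed_subspace (orlicz X N Phi) (orlicz_norm X N Phi) ->
  solid (orlicz X N Phi) (orlicz_norm X N Phi).
Proof.
move=> cPhi [sub _ _ NZ ND] u v Vv uv.
have same (w w' : M0 mu) :
    (\forall t \ae mu, normc (M0_fun w t) = normc (M0_fun w' t)) ->
    orlicz X N Phi w' ->
    orlicz X N Phi w /\ orlicz_norm X N Phi w = orlicz_norm X N Phi w'.
  by move=> h; rewrite /orlicz /orlicz_norm /= (@luxemburg_normc _ _ _ w w').
pose a t := normc (M0_fun u t).
pose b t := Num.sqrt (normc (M0_fun v t) ^+ 2 - a t ^+ 2).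
have ma : measurable_fun setT a by exact/measurable_normc/M0_fun_cmeas.
have mb : measurable_fun setT b.
  apply: measurableT_comp; first exact: measurable_sqrt.
  apply: measurable_funB; apply: measurable_funX => //.
  exact/measurable_normc/M0_fun_cmeas.
pose wp := M0_class mu (fun t => a t +i* b t).
pose wm := M0_class mu (fun t => a t -i* b t).
pose w := M0_class mu (fun t => (a t)%:C).
have mp : (fun t => a t +i* b t) \in @cmeas _ T R by exact: cmeas_complex.
have mm : (fun t => a t -i* b t) \in @cmeas _ T R.
  by apply: cmeas_complex => //; exact: measurableT_comp.
have mw : (fun t => (a t)%:C) \in @cmeas _ T R by exact: cmeas_real.
have mod_v t : a t <= normc (M0_fun v t) ->
    Num.sqrt (a t ^+ 2 + b t ^+ 2) = normc (M0_fun v t).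
  move=> av; rewrite /b sqr_sqrtr.
    by rewrite addrC subrK sqrtr_sqr ger0_norm// normc_ge0.
  by rewrite subr_ge0 lerXn2r// nnegrE normc_ge0.
have [Vp Np] : orlicz X N Phi wp /\
    orlicz_norm X N Phi wp = orlicz_norm X N Phi v.
  apply: same => //; apply: filterS2 uv (M0_fun_class mu mp) => t av -> /=.
  exact: mod_v.
have [Vm Nm] : orlicz X N Phi wm /\
    orlicz_norm X N Phi wm = orlicz_norm X N Phi v.
  apply: same => //; apply: filterS2 uv (M0_fun_class mu mm) => t av -> /=.
  by rewrite sqrrN; exact: mod_v.
have half : w = (2^-1)%:C *: (wp + wm).
  apply: M0_ext; apply: filter_app2 (M0_fun_class mu mp) (M0_fun_class mu mm).
  apply: filterS3 (M0_fun_class mu mw) (M0_funZ (2^-1)%:C (wp + wm))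
    (M0_funD wp wm) => t /= -> -> -> -> ->.
  by apply/eqP; rewrite eq_complex /=; apply/andP; split; apply/eqP; field.
have [Vu ->] : orlicz X N Phi u /\
    orlicz_norm X N Phi u = orlicz_norm X N Phi w.
  apply: same; last by rewrite half; apply: submodZ => //; exact: submodD.
  by apply: filterS (M0_fun_class mu mw) => t ->; rewrite normc_real// normc_ge0.
split => //; rewrite half NZ; last exact: submodD.
rewrite normc_real ?invr_ge0//.
have := ND _ _ Vp Vm; rewrite Np Nm; lra.
Qed.

Lemma chi_cmeas (A : set T) : measurable A ->
  (fun t => (\1_A t : R)%:C) \in @cmeas _ T R.
Proof. by move=> mA; apply: cmeas_real; exact: measurable_indic. Qed.

Lemma chi_fun (A : set T) : measurable A ->
  \forall t \ae mu, M0_fun (chi mu A) t = (\1_A t : R)%:C.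
Proof. by move=> mA; exact/M0_fun_class/chi_cmeas. Qed.

Lemma young_comp_chi Phi (A : set T) c l : continuous_young Phi -> Phi 0 = 0 ->
  measurable A -> 0 <= c -> 0 < l ->
  young_comp Phi (c%:C *: chi mu A) l = (Phi (c / l))%:C *: chi mu A.
Proof.
move=> cPhi Phi0 mA c0 l0; apply: M0_ext.
apply: filter_app2 (M0_funZ c%:C (chi mu A)) (chi_fun mA).
apply: filterS2
  (M0_fun_class mu (young_comp_cmeas (c%:C *: chi mu A) cPhi l0))
  (M0_funZ (Phi (c / l))%:C (chi mu A)) => t /= -> -> -> ->.
rewrite indicE; case: (t \in A).
  by rewrite !mulr1 normc_real.
by rewrite !mulr0 normc0 mul0r Phi0.
Qed.

(** [young_comp] turns a multiple of [chi mu A] into another multiple of it, so the last inequality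
    says that [l] is admissible in the infimum. *)
Lemma orlicz_scaled_chi_le X N Phi (A : set T) c l :
  normed_subspace X N -> young_function Phi -> continuous_young Phi ->
  measurable A -> X (chi mu A) ->
  0 <= c -> 0 < l -> Phi (c / l) * N (chi mu A) <= 1 ->
  orlicz X N Phi (c%:C *: chi mu A) /\ orlicz_norm X N Phi (c%:C *: chi mu A) <= l.
Proof.
move=> [sub _ _ NZ _] [Phi_ge0 _ Phi0 _ _] cPhi mA XA c0 l0 h.
have lux_le : (luxemburg X N Phi (c%:C *: chi mu A) <= l%:E)%E.
  apply: ereal_inf_lbound; exists l => //=; rewrite young_comp_chi//.
  split => //; first exact: submodZ.
  by rewrite NZ// normc_real// Phi_ge0// divr_ge0// ltW.
(* With the upper bound this makes the infimum finite, so that [fine] returns its true value. *)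
have lux_ge0 : (0 <= luxemburg X N Phi (c%:C *: chi mu A))%E.
  by apply: le_ereal_inf_tmp => _ [l' [l'0 _ _] <-]; rewrite lee_fin ltW.
have V : orlicz X N Phi (c%:C *: chi mu A).
  by rewrite /orlicz /=; apply: le_lt_trans lux_le _; exact: ltry.
split => //; rewrite /orlicz_norm -lee_fin fineK//.
by rewrite ge0_fin_numE.
Qed.

(** No [l < 1] is admissible: then [c <= c / l], and monotonicity of [Phi] keeps the norm above 1.
    Membership in the Orlicz space matters, since [fine] would send [+oo] to 0. *)
Lemma orlicz_scaled_chi_ge X N Phi (A : set T) c :
  normed_subspace X N -> young_function Phi -> strictly_increasing_young Phi ->
  continuous_young Phi -> measurable A -> X (chi mu A) ->
  0 <= c -> 1 < Phi c * N (chi mu A) -> orlicz X N Phi (c%:C *: chi mu A) ->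
  1 <= orlicz_norm X N Phi (c%:C *: chi mu A).
Proof.
move=> [_ N_ge0 _ NZ _] [Phi_ge0 _ Phi0 _ _] incr cPhi mA XA c0 h.
rewrite /orlicz /orlicz_norm /= => fin.
have lux_ge1 : (1%:E <= luxemburg X N Phi (c%:C *: chi mu A))%E.
  apply: le_ereal_inf_tmp => _ [l [l0 Xl Nl] <-]; rewrite lee_fin leNgt.
  apply/negP => l1; move: Nl; rewrite young_comp_chi// NZ//.
  have cl : c <= c / l by rewrite ler_peMr// invf_ge1// ltW.
  have cl0 : 0 <= c / l by rewrite divr_ge0// ltW.
  rewrite normc_real ?Phi_ge0//; apply/negP; rewrite -ltNge.
  apply: (lt_le_trans h); apply: ler_wpM2r; first exact: N_ge0.
  (* [incr] handles strict inequalities only, so equality is split off. *)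
  move: cl; rewrite le_eqVlt => /predU1P[<- //|cl].
  by apply/ltW/incr; rewrite ?in_itv/= ?c0 ?cl0.
rewrite -lee_fin fineK// ge0_fin_numE//; apply: le_trans lux_ge1.
by rewrite lee_fin.
Qed.

End OrliczSolid.

(** * Disjoint pieces carved out of a diffuse set *)

Section DisjointPieces.
Local Open Scope complex_scope.
Context d (T : measurableType d) (R : realType) (mu : {measure set T -> \bar R}).
Implicit Types (X : set (M0 mu)) (N : M0 mu -> R) (Y F : set T).

Lemma chi_setD Y F : measurable Y -> measurable F -> F `<=` Y ->
  chi mu (Y `\` F) = chi mu Y - chi mu F.
Proof.
move=> mY mF FY; apply: M0_ext.
apply: filter_app2 (chi_fun mu mY) (chi_fun mu mF).
apply: filterS2 (chi_fun mu (measurableD mY mF)) (M0_funB (chi mu Y) (chi mu F)).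
move=> t /= -> -> -> ->; rewrite !indicE in_setD.
have [tF|tF] := boolP (t \in F); last by rewrite andbT subr0.
have -> : t \in Y by rewrite inE; apply: FY; rewrite -inE.
by rewrite andbF subrr.
Qed.

Lemma chi_eq0 Y : measurable Y -> chi mu Y = 0 -> mu Y = 0%E.
Proof.
move=> mY Y0; apply: measure_negligible => //.
have : \forall t \ae mu, ~ Y t.
  apply: filterS2 (chi_fun mu mY) (M0_fun0 mu) => t; rewrite Y0 => -> /eqP.
  by rewrite eq_complex /= indicE => /andP[+ _] Yt; rewrite mem_set// oner_eq0.
by apply: negligibleS => t Yt /(_ Yt).
Qed.

(** Greedy cutting: the piece [A n] is taken from the remainder [B n]. The norm need not be
    monotone, but the triangle inequality shows that removing [A n] lowers the norm of the remainder
    by at most [alpha n], so [B n] keeps norm at least [N (chi mu E) / 2 ^+ n]. *)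
Lemma diffuse_disjoint X N E (alpha : nat -> R) :
  normed_subspace X N -> diffuse X N E ->
  (forall n, 0 <= alpha n <= N (chi mu E) / 2 ^+ n.+1) ->
  exists A : nat -> set T, [/\ forall n, measurable (A n), trivIset setT A,
    forall n, X (chi mu (A n)) & forall n, N (chi mu (A n)) = alpha n].
Proof.
move=> nX [mE XE dE] alphaP; have [sub _ _ _ ND] := nX.
(* Diffuseness is put as an implication so that the choice function is total; on inadmissible pairs
   its value is the arbitrary [set0]. *)
have /choice[f fP] : forall p : set T * R, exists F,
    measurable p.1 -> p.1 `<=` E -> X (chi mu p.1) ->
    0 <= p.2 -> p.2 <= N (chi mu p.1) ->
    [/\ measurable F, F `<=` p.1, X (chi mu F) & N (chi mu F) = p.2].
  move=> [Y a] /=.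
  have [[mY YE XY a0 aN]|H] := pselect [/\ measurable Y, Y `<=` E,
      X (chi mu Y), 0 <= a & a <= N (chi mu Y)].
    by have [F FP] := dE Y mY YE XY a a0 aN; exists F.
  by exists set0 => *; exfalso; apply: H.
pose fix B n := if n is k.+1 then B k `\` f (B k, alpha k) else E.
pose A n := f (B n, alpha n).
have half n : N (chi mu E) / 2 ^+ n.+1 = N (chi mu E) / 2 ^+ n / 2.
  by rewrite exprSr invfM mulrA.
have e0 : 0 <= N (chi mu E).
  have /andP[a0 aN] := alphaP 0%N; have := le_trans a0 aN.
  by rewrite pmulr_lge0 ?invr_gt0 ?exprn_gt0.
have BP n : [/\ measurable (B n), B n `<=` E, X (chi mu (B n)) &
    N (chi mu E) / 2 ^+ n <= N (chi mu (B n))].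
  elim: n => [|n [mB BE XB NB]]; first by rewrite expr0 divr1; split.
  have /andP[a0 aN] := alphaP n; rewrite half in aN.
  have q0 : 0 <= N (chi mu E) / 2 ^+ n by rewrite divr_ge0// exprn_ge0.
  have [|mA AB XA NA] := fP (B n, alpha n) mB BE XB a0; first by rewrite /=; lra.
  split => /=; first exact: measurableD.
  - by move=> t [/BE].
  - by rewrite chi_setD//; exact: submodB.
  - have := ND (chi mu (B n `\` A n)) (chi mu (A n)).
    rewrite chi_setD// subrK half => /(_ (submodB sub XB XA) XA).
    by rewrite -chi_setD// NA /=; lra.
have AP n : [/\ measurable (A n), A n `<=` B n, X (chi mu (A n)) &
    N (chi mu (A n)) = alpha n].
  have [mB BE XB NB] := BP n; have /andP[a0 aN] := alphaP n.
  apply: fP => //=; apply: le_trans aN _; apply: le_trans NB.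
  rewrite half ler_pdivrMr// ler_peMr ?ler1n// divr_ge0// exprn_ge0//.
exists A; split; try by move=> n; have [] := AP n.
(* Remainders decrease, so for [m < n] the piece [A n] lies in [B m.+1], which avoids [A m]. *)
have Bdec m n : (m <= n)%N -> B n `<=` B m.
  elim: n => [|n IH]; first by rewrite leqn0 => /eqP ->.
  rewrite leq_eqVlt ltnS => /predU1P[-> //|mn].
  by apply: subset_trans (IH mn) => t [].
apply: ltn_trivIset => n m mn; apply/seteqP; split=> // t [Am An].
have [_ /(_ _ An) Bn _ _] := AP n.
by have [_ /(_ Am)] := Bdec _ _ mn _ Bn.
Qed.

(** The value 0 of [nu] is kept for points outside all pieces, hence the shift [n.+1]. Every [h]
    gives a measurable composition because the preimage of a set is a countable union of fibres of
    [nu]. *)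
Lemma disjoint_index (A : nat -> set T) : (forall n, measurable (A n)) ->
  trivIset setT A ->
  exists nu : T -> nat, (forall n t, nu t = n.+1 <-> A n t) /\
    (forall h : nat -> R, measurable_fun setT (h \o nu)).
Proof.
move=> mA tA.
have /choice[nu nuP] : forall t, exists k : nat,
    if k is n.+1 then A n t else forall n, ~ A n t.
  move=> t; have [[n An]|H] := pselect (exists n, A n t).
    by exists n.+1.
  by exists 0%N => n An; apply: H; exists n.
have nuE n t : nu t = n.+1 <-> A n t.
  split=> [tn|An]; have := nuP t; first by rewrite tn.
  case: (nu t) => [/(_ n)//|m Am]; congr S.
  by apply: (tA m n I I); exists t.
exists nu; split => //.
have mfib n : measurable (nu @^-1` [set n]).
  case: n => [|n].
    rewrite (_ : _ @^-1` _ = ~` \bigcup_n A n).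
      by apply: measurableC; exact: bigcup_measurable.
    apply/seteqP; split=> t /= => [t0 [n _ /nuE]|H]; first by rewrite t0.
    by case E : (nu t) => [//|n]; case: H; exists n => //; exact/nuE.
  rewrite (_ : _ @^-1` _ = A n)//.
  by apply/seteqP; split=> t /= /nuE.
move=> h _ Y mY; rewrite setTI.
rewrite (_ : _ @^-1` _ = \bigcup_(n in [set n | Y (h n)]) (nu @^-1` [set n])).
  by apply: bigcup_measurable => n _.
apply/seteqP; split=> t /= => [Yt|[n Yn /= ->]//].
by exists (nu t).
Qed.

End DisjointPieces.

(** * Modulus and completeness of the complex numbers *)

Section Complex.
Local Open Scope complex_scope.
Context (R : realType).

Lemma le_normr_Re (z : R[i]) : `|complex.Re z| <= normc z.
Proof.
by case: z => a b /=; rewrite -sqrtr_sqr ler_wsqrtr// lerDl sqr_ge0.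
Qed.

Lemma le_normr_Im (z : R[i]) : `|complex.Im z| <= normc z.
Proof.
by case: z => a b /=; rewrite -sqrtr_sqr ler_wsqrtr// lerDr sqr_ge0.
Qed.

Lemma normc_le_ReIm (z : R[i]) :
  normc z <= `|complex.Re z| + `|complex.Im z|.
Proof.
case: z => a b /=; rewrite -[leRHS]ger0_norm ?addr_ge0// -sqrtr_sqr.
rewrite ler_wsqrtr// sqrrD !real_normK ?num_real//.
by rewrite lerD2r lerDl mulrn_wge0// mulr_ge0.
Qed.

Lemma real_cauchy (x : nat -> R) :
  (forall e, 0 < e -> exists k0, forall k j, (k0 <= k)%N -> (k0 <= j)%N ->
    `|x k - x j| < e) ->
  exists l, forall e, 0 < e -> exists k0, forall k, (k0 <= k)%N -> `|x k - l| < e.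
Proof.
move=> cx; have : cvgn x.
  apply/cauchy_cvgP/cauchy_ballP => e e0; near_simpl.
  have [k0 k0P] := cx e e0.
  exists ([set k | (k0 <= k)%N], [set k | (k0 <= k)%N]) => /=.
    by split; exists k0.
  by move=> [k j] /= [kk kj]; rewrite /ball /=; exact: k0P.
move=> /cvg_ex[l xl]; exists l => e e0.
move/cvgrPdist_lt: xl => /(_ e e0)[k0 _ k0P].
by exists k0 => k /k0P /=; rewrite distrC.
Qed.

Lemma complex_cauchy (z : nat -> R[i]) :
  (forall e, 0 < e -> exists k0, forall k j, (k0 <= k)%N -> (k0 <= j)%N ->
    normc (z k - z j) < e) ->
  exists l, forall e, 0 < e ->
    exists k0, forall k, (k0 <= k)%N -> normc (z k - l) < e.
Proof.
move=> cz.
have ReB (x y : R[i]) : complex.Re (x - y) = complex.Re x - complex.Re y.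
  by case: x y => [? ?] [? ?].
have ImB (x y : R[i]) : complex.Im (x - y) = complex.Im x - complex.Im y.
  by case: x y => [? ?] [? ?].
have [|a aP] := @real_cauchy (fun k => complex.Re (z k)).
  move=> e /cz[k0 k0P]; exists k0 => k j kk kj.
  by rewrite -ReB; apply: le_lt_trans (le_normr_Re _) (k0P _ _ kk kj).
have [|b bP] := @real_cauchy (fun k => complex.Im (z k)).
  move=> e /cz[k0 k0P]; exists k0 => k j kk kj.
  by rewrite -ImB; apply: le_lt_trans (le_normr_Im _) (k0P _ _ kk kj).
exists (a +i* b) => e e0; have e20 : 0 < e / 2 by rewrite divr_gt0.
have [ka kaP] := aP _ e20; have [kb kbP] := bP _ e20.
exists (maxn ka kb) => k; rewrite geq_max => /andP[/kaP + /kbP].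
have := normc_le_ReIm (z k - (a +i* b)); rewrite ReB ImB /=; lra.
Qed.

End Complex.

(** * Functions constant on the fibres of an index map *)

Section Simple.
Local Open Scope complex_scope.
Context d (T : measurableType d) (R : realType) (mu : {measure set T -> \bar R}).
Variable nu : T -> nat.
Hypothesis mnu : forall h : nat -> R, measurable_fun setT (h \o nu).
Implicit Types (u v l : M0 mu) (b : nat -> R[i]) (q : pred nat).

Definition index_class b : M0 mu := M0_class mu (fun t => b (nu t)).

Lemma index_class_fun b : \forall t \ae mu, M0_fun (index_class b) t = b (nu t).
Proof.
apply: M0_fun_class; rewrite inE; split.
  exact: (mnu (fun k => complex.Re (b k))).
exact: (mnu (fun k => complex.Im (b k))).
Qed.

Definition restr q u : M0 mu :=
  M0_class mu (fun t => if q (nu t) then M0_fun u t else 0).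

Lemma restr_fun q u :
  \forall t \ae mu, M0_fun (restr q u) t = if q (nu t) then M0_fun u t else 0.
Proof.
apply: M0_fun_class.
have [mR mI] : measurable_fun setT (fun t => complex.Re (M0_fun u t)) /\
    measurable_fun setT (fun t => complex.Im (M0_fun u t)).
  by have := M0_fun_cmeas u; rewrite inE.
have mq := mnu (fun k => (q k)%:R); rewrite inE; split.
  rewrite (_ : (fun t => _) =
      (fun t => (q (nu t))%:R * complex.Re (M0_fun u t))).
    exact: measurable_funM.
  by apply/funext => t; case: (q _); rewrite ?mul1r ?mul0r.
rewrite (_ : (fun t => _) =
    (fun t => (q (nu t))%:R * complex.Im (M0_fun u t))).
  exact: measurable_funM.
by apply/funext => t; case: (q _); rewrite ?mul1r ?mul0r.
Qed.

(* Norm approximation forces equality a.e. because the norm is monotone. *)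
Lemma solid_limit V (N : M0 mu -> R) q l b :
  normed_subspace V N -> solid V N ->
  (forall e, 0 < e -> exists v, [/\ V v, N v < e & \forall t \ae mu,
    q (nu t) -> normc (M0_fun l t - b (nu t)) <= normc (M0_fun v t)]) ->
  \forall t \ae mu, q (nu t) -> M0_fun l t = b (nu t).
Proof.
move=> nV sV app; pose z := restr q (l - index_class b).
have zE : \forall t \ae mu,
    M0_fun z t = if q (nu t) then M0_fun l t - b (nu t) else 0.
  apply: filterS3 (restr_fun q (l - index_class b)) (M0_funB l (index_class b)) (index_class_fun b).
  by move=> t -> -> ->.
have zlt e : 0 < e -> V z /\ N z < e.
  move=> /app[v [Vv Nv lv]]; have [] := sV z v Vv; last first.
    by move=> Vz Nz; split => //; exact: le_lt_trans Nz Nv.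
  apply: filterS2 zE lv => t ->.
  by case: (q _) => [|_]; [exact|rewrite normc0 normc_ge0].
have [Vz _] := zlt 1 ltr01.
have [_ N_ge0 N_eq0 _ _] := nV.
have z0 : z = 0.
  apply: N_eq0 => //; apply/eqP; rewrite eq_le N_ge0// andbT leNgt.
  by apply/negP => Nz0; have [_] := zlt _ Nz0; rewrite ltxx.
apply: filterS2 zE (M0_fun0 mu) => t; rewrite z0 => -> H qt.
by move: H; rewrite qt => /eqP; rewrite subr_eq0 => /eqP.
Qed.

End Simple.

(** * The subspace of blockwise multiples of one function *)

Section SpaceableCore.
Local Open Scope complex_scope.
Context d (T : measurableType d) (R : realType) (mu : {measure set T -> \bar R}).
Variable nu : T -> nat.
Hypothesis mnu : forall h : nat -> R, measurable_fun setT (h \o nu).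
Variables (V V1 : set (M0 mu)) (N N1 : M0 mu -> R).
Hypotheses (nV : normed_subspace V N) (cV : complete_subspace V N).
Hypotheses (sV : solid V N) (nV1 : normed_subspace V1 N1) (sV1 : solid V1 N1).
Variable c : nat -> R.
Hypothesis c0 : c 0%N = 0.
Let piece n : M0 mu := index_class mu nu (fun k => if k == n.+1 then (c k)%:C else 0).
Hypothesis V_piece : forall n, V (piece n) /\ N (piece n) <= (2 ^+ n)^-1.
Hypothesis V1_piece : forall n, V1 (piece n) -> n.+1%:R <= N1 (piece n).
(** [kappa] sorts the pieces into classes; the hypothesis below makes every class infinite. *)
Variable kappa : nat -> nat.
Hypothesis kappa_fiber : forall m j, exists n, (j <= n)%N /\ kappa n.+1 = m.
Implicit Types (u v w l : M0 mu) (b : nat -> R[i]) (n m k : nat).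

Let subV : submod_closed (mem V). Proof. by case: nV. Qed.

(** The pointwise sum of all pieces; [c0] makes it vanish outside them. *)
Let F : M0 mu := index_class mu nu (fun k => (c k)%:C).
Let partial m : M0 mu := index_class mu nu (fun k => if (k <= m)%N then (c k)%:C else 0).

Lemma partialS m : partial m.+1 = partial m + piece m.
Proof.
apply: M0_ext.
apply: filter_app2 (index_class_fun mu mnu (fun k => if (k <= m)%N then (c k)%:C else 0))
  (index_class_fun mu mnu (fun k => if k == m.+1 then (c k)%:C else 0)).
apply: filterS2 (M0_funD (partial m) (piece m))
  (index_class_fun mu mnu (fun k => if (k <= m.+1)%N then (c k)%:C else 0)) => t.
move=> -> -> -> ->; rewrite leq_eqVlt ltnS; have [->|] /= := eqVneq (nu t) m.+1.
  by rewrite ltnn add0r.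
by move=> _; rewrite addr0.
Qed.

Lemma V_partial m : V (partial m).
Proof.
elim: m => [|m IH]; last first.
  by rewrite partialS; apply: submodD => //; case: (V_piece m).
suff -> : partial 0 = 0 by exact: submod0.
apply: M0_ext; apply: filterS2 (M0_fun0 mu)
  (index_class_fun mu mnu (fun k => if (k <= 0)%N then (c k)%:C else 0)) => t -> ->.
by rewrite leqn0; case: eqP => // ->; rewrite c0.
Qed.

(** The right side is the exact value of the geometric sum of [2^-i] for [m <= i < m + k], which
    lets the induction close. *)
Lemma partial_sub m k :
  N (partial (m + k) - partial m) <= 2 / 2 ^+ m - 2 / 2 ^+ (m + k).
Proof.
elim: k => [|k IH].
  by rewrite addn0 !subrr (normed_subspace0 nV).
have [_ _ _ _ ND] := nV.
rewrite addnS partialS addrAC; apply: le_trans (ND _ _ _ _) _.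
- by apply: submodB => //; exact: V_partial.
- by case: (V_piece (m + k)).
- have [_] := V_piece (m + k); rewrite exprS invfM.
  by set x := (2 ^+ (m + k))^-1 in IH *; move: IH; lra.
Qed.

Lemma geometric_small (e : R) : 0 < e -> exists n, 2 / 2 ^+ n < e.
Proof.
move=> e0; exists (Num.bound (2 / e)); rewrite ltr_pdivrMr ?exprn_gt0//.
rewrite mulrC -ltr_pdivrMr//; apply: lt_le_trans (archi_boundP _) _.
  by rewrite divr_ge0// ltW.
by rewrite -natrX ler_nat ltnW// ltn_expl.
Qed.

(** The partial sums are Cauchy, so completeness gives a limit [s]. By [solid_limit] it agrees with
    [F] on every piece, and solidity transfers membership from [s] to [F]. *)
Lemma V_sum : V F.
Proof.
have [|s Vs slim] := cV V_partial.
  move=> e e0; have [n0 n0P] := geometric_small e0; exists n0.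
  have step m k : (n0 <= m)%N -> (m <= k)%N -> N (partial k - partial m) < e.
    move=> mn mk; rewrite -(subnKC mk); apply: le_lt_trans (partial_sub _ _) _.
    apply: le_lt_trans n0P; rewrite lerBlDr ler_wpDr ?divr_ge0 ?exprn_ge0//.
    by rewrite ler_pM2l// lef_pV2 ?posrE ?exprn_gt0// ler_eXn2l// ltr1n.
  move=> m k mn kn; have [mk|/ltnW km] := leqP m k; last exact: step.
  by rewrite (normed_subspace_sub nV) ?step//; exact: V_partial.
have loc n : \forall t \ae mu, nu t == n.+1 -> M0_fun s t = (c (nu t))%:C.
  apply: (solid_limit (q := pred1 n.+1) (b := fun k => (c k)%:C) mnu nV sV).
  move=> e e0; move/cvgrPdist_lt : slim => /(_ e e0)[m0 _ m0P].
  (* From [n.+1] on, the partial sums already have their final value on the fibre [n.+1]. *)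
  pose m := maxn m0 n.+1.
  have Vd : V (s - partial m) by apply: submodB => //; exact: V_partial.
  exists (s - partial m); split => //.
    rewrite (normed_subspace_sub nV)//; last exact: V_partial.
    apply: le_lt_trans (m0P m (leq_maxl _ _)).
    by rewrite sub0r normrN ler_norm.
  apply: filterS2 (M0_funB s (partial m))
    (index_class_fun mu mnu (fun k => if (k <= m)%N then (c k)%:C else 0)) => t -> ->.
  by move=> /eqP ->; rewrite leq_maxr.
(* Outside the pieces [s] has not been identified, but [F] is 0 there, so domination still holds. *)
have [] // := sV (u := F) Vs _.
apply: filterS2 (index_class_fun mu mnu (fun k => (c k)%:C)) (ae_foralln loc) => t -> st.
case nt : (nu t) => [|n]; first by rewrite c0 normc0 normc_ge0.
by rewrite (st n) nt.
Qed.

(** [u] is [F] multiplied by the constant [b m] on each class [m]; no convergent series is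
    involved. *)
Definition represents u b : Prop :=
  \forall t \ae mu, M0_fun u t = b (kappa (nu t)) * (c (nu t))%:C.

Lemma piece_fun n : \forall t \ae mu,
  M0_fun (piece n) t = if nu t == n.+1 then (c (nu t))%:C else 0.
Proof. exact: (index_class_fun mu mnu (fun k => if k == n.+1 then (c k)%:C else 0)). Qed.

(** A zero piece would lie in [V1] with norm 0, against the lower bound [n.+1] of [V1_piece]. *)
Lemma N_piece_gt0 n : 0 < N (piece n).
Proof.
have [_ N_ge0 N_eq0 _ _] := nV; have [Vp _] := V_piece n.
rewrite lt_neqAle N_ge0// andbT eq_sym; apply/eqP => /(N_eq0 _ Vp) p0.
have [sub1 _ _ _ _] := nV1; have := @V1_piece n.
by rewrite p0 (normed_subspace0 nV1) => /(_ (submod0 sub1)); rewrite lern0.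
Qed.

Lemma represents0 : represents 0 (fun=> 0).
Proof. by apply: filterS (M0_fun0 mu) => t ->; rewrite mul0r. Qed.

Lemma representsDZ a u v b b' : represents u b -> represents v b' ->
  represents (a *: u + v) (fun m => a * b m + b' m).
Proof.
move=> ub vb; apply: filter_app2 ub vb.
apply: filterS2 (M0_funD (a *: u) v) (M0_funZ a u) => t -> -> -> ->.
by rewrite mulrDl mulrA.
Qed.

Lemma representsB u v b b' : represents u b -> represents v b' ->
  represents (u - v) (fun m => b m - b' m).
Proof.
move=> ub vb; apply: filterS3 (M0_funB u v) ub vb => t -> -> ->.
by rewrite mulrBl.
Qed.

(** The restriction of [u] to one piece is dominated by [u]. The ambient space is arbitrary because
    both [V] and [V1] are needed. *)
Lemma represents_piece_le u b n (U : set (M0 mu)) (NU : M0 mu -> R) :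
  normed_subspace U NU -> solid U NU -> represents u b -> U u ->
  U (b (kappa n.+1) *: piece n) /\
  NU (b (kappa n.+1) *: piece n) <= NU u.
Proof.
move=> nU sU ub Uu; apply: sU => //.
apply: filterS3 (M0_funZ (b (kappa n.+1)) (piece n)) (piece_fun n) ub.
move=> t -> -> ->; case: eqP => [->|_]; first exact: lexx.
by rewrite mulr0 normc0 normc_ge0.
Qed.

(** Continuity of the coefficient functionals, from which uniqueness and convergence of coefficients
    follow. *)
Lemma represents_coef_le u b n : represents u b -> V u ->
  normc (b (kappa n.+1)) * N (piece n) <= N u.
Proof.
move=> ub Vu; have [_ _ _ NZ _] := nV.
have [_] := represents_piece_le n nV sV ub Vu.
by rewrite NZ//; case: (V_piece n).
Qed.

Lemma represents_inj u b b' m : represents u b -> represents u b' -> V u ->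
  b m = b' m.
Proof.
move=> ub ub' Vu; have [n [_ nm]] := kappa_fiber m 0.
have := represents_coef_le n (representsB ub ub').
rewrite subrr (normed_subspace0 nV) nm => /(_ (submod0 subV)).
rewrite pmulr_lle0 ?N_piece_gt0// => le0; apply/eqP; rewrite -subr_eq0.
by apply/eqP/eq0_normc/eqP; rewrite eq_le le0 normc_ge0.
Qed.

Let W : set (M0 mu) := [set u | V u /\ exists b, represents u b].

(** If [b m] is nonzero and [u] is in [V1], then [N1 u] bounds [n.+1] times the modulus of [b m] for
    infinitely many [n], which is absurd. *)
Lemma W_notin_V1 : W `<=` (V `\` V1) `|` [set 0].
Proof.
move=> u [Vu [b ub]].
have [b0|] := pselect (forall m, b m = 0).
  right; apply: M0_ext; apply: filterS2 ub (M0_fun0 mu) => t -> ->.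
  by rewrite b0 mul0r.
move=> /existsNP[m bm]; left; split => // V1u.
have nbm : 0 < normc (b m).
  rewrite lt_neqAle normc_ge0 andbT eq_sym.
  by apply/eqP => /eq0_normc.
have [n [jn nm]] := kappa_fiber m (Num.bound (N1 u / normc (b m))).
have [sub1 N1_ge0 _ NZ1 _] := nV1.
have [V1p] := represents_piece_le n nV1 sV1 ub V1u; rewrite nm in V1p *.
(* [V1_piece] asks for the piece itself in [V1], so the nonzero scalar [b m] is divided out. *)
have V1pn : V1 (piece n).
  have := submodZ (b m)^-1 sub1 V1p; rewrite scalerA mulVf ?scale1r//.
  exact/eqP.
rewrite NZ1//; apply/negP; rewrite -ltNge -ltr_pdivrMl// mulrC.
apply: lt_le_trans (V1_piece V1pn).
apply: lt_le_trans (archi_boundP _) _; first by rewrite divr_ge0 ?N1_ge0 ?ltW.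
by rewrite ler_nat leqW.
Qed.

Lemma W_submod : submod_closed (mem W).
Proof.
split.
  rewrite inE; split; first exact: submod0.
  by exists (fun=> 0); exact: represents0.
move=> a u v; rewrite !inE => -[Vu [b ub]] [Vv [b' vb']]; split.
  by apply: submodD => //; exact: submodZ.
by exists (fun m => a * b m + b' m); exact: representsDZ.
Qed.

(** Coefficients of approximants are Cauchy by [represents_coef_le]; their limits [beta] represent
    [l], as [solid_limit] shows on each class separately. *)
Lemma W_closed : closed_in V N W.
Proof.
move=> l Vl app; have [_ N_ge0 _ NZ ND] := nV.
have /choice[w wP] : forall k : nat, exists w, W w /\ N (w - l) < 2 / 2 ^+ k.
  move=> k; have [|w] := app (2 / 2 ^+ k); last by exists w.
  by rewrite divr_gt0 ?exprn_gt0.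
have Vw k : V (w k) by have [[]] := wP k.
have /choice[b bP] : forall k, exists b, represents (w k) b.
  by move=> k; have [[_]] := wP k.
have Nwl e : 0 < e -> exists k0, forall k, (k0 <= k)%N -> N (w k - l) < e.
  move=> e0; have [k0 k0P] := geometric_small e0; exists k0 => k kk.
  have [_ /lt_le_trans] := wP k; apply; apply: le_trans (ltW k0P).
  by rewrite ler_pM2l// lef_pV2 ?posrE ?exprn_gt0// ler_eXn2l// ltr1n.
have /choice[beta betaP] : forall m, exists z, forall e, 0 < e ->
    exists k0, forall k, (k0 <= k)%N -> normc (b k m - z) < e.
  move=> m; apply: complex_cauchy => e e0.
  have [n [_ nm]] := kappa_fiber m 0; have p0 := N_piece_gt0 n.
  have [|k0 k0P] := Nwl (e * N (piece n) / 2); first by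
    rewrite divr_gt0// mulr_gt0.
  exists k0 => k j kk kj; rewrite -(ltr_pM2r p0) -nm.
  apply: le_lt_trans (represents_coef_le n (representsB (bP k) (bP j)) _) _.
    exact: submodB.
  rewrite (_ : w k - w j = (w k - l) - (w j - l)); last first.
    by rewrite opprB addrA subrK.
  apply: le_lt_trans (normed_subspaceB nV _ _) _; try exact: submodB.
  by have := k0P _ kk; have := k0P _ kj; lra.
split => //; exists beta.
(* There are countably many classes, so the exceptional null sets can be united. *)
suff loc m : \forall t \ae mu,
    kappa (nu t) == m -> M0_fun l t = beta (kappa (nu t)) * (c (nu t))%:C.
  by apply: filterS (ae_foralln loc) => t; apply.
apply: (solid_limit (q := fun k => kappa k == m)
  (b := fun k => beta (kappa k) * (c k)%:C) mnu nV sV) => e e0.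
(* Adding 1 gives a positive divisor without asking whether [N F] is nonzero. *)
have NF1 : 0 < N F + 1 by rewrite ltr_wpDl// N_ge0//; exact: V_sum.
have [|k1 k1P] := betaP m (e / 2 / (N F + 1)); first by rewrite !divr_gt0.
have [|k2 k2P] := Nwl (e / 2); first by rewrite divr_gt0.
pose k := maxn k1 k2; pose a := b k m - beta m.
have Vl' : V (l - w k) by exact: submodB.
have Va : V (a *: F) by apply: submodZ => //; exact: V_sum.
(* On class [m] this function equals [l - beta m *: F], because [w k] equals [b k m *: F] there. *)
exists ((l - w k) + a *: F); split; first exact: submodD.
  apply: le_lt_trans (ND _ _ _ _) _ => //; rewrite NZ; last exact: V_sum.
  rewrite (normed_subspace_sub nV)//.
  have := k2P k (leq_maxr _ _); have := k1P k (leq_maxl _ _).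
  rewrite ltr_pdivlMr// mulrDr mulr1 -/a.
  by have := normc_ge0 a; lra.
apply: filter_app2 (bP k) (index_class_fun mu mnu (fun k => (c k)%:C)).
apply: filterS3 (M0_funD (l - w k) (a *: F)) (M0_funB l (w k)) (M0_funZ a F).
move=> t -> -> -> -> -> /eqP km; rewrite /a -km.
by rewrite le_eqVlt; apply/orP; left; apply/eqP; congr normc; ring.
Qed.

(** The block function, [F] cut down to class [m], lies in [V] since [F] dominates it. *)
Lemma W_basis m : exists2 u, W u & represents u (fun k => (k == m)%:R).
Proof.
pose u := index_class mu nu (fun k => (kappa k == m)%:R * (c k)%:C).
have ub : represents u (fun k => (k == m)%:R).
  exact: (index_class_fun mu mnu (fun k => (kappa k == m)%:R * (c k)%:C)).
exists u => //; split; last by exists (fun k => (k == m)%:R).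
have [] // := sV (u := u) V_sum _.
apply: filterS2 ub (index_class_fun mu mnu (fun k => (c k)%:C)) => t -> ->.
by case: eqP => _; rewrite ?mul1r// mul0r normc0 normc_ge0.
Qed.

(** If [n] elements spanned [W], expanding [n.+1] block functions in them and comparing coefficients
    would factor the identity matrix of size [n.+1] through dimension [n]. *)
Lemma W_infinite : infinite_dimensional W.
Proof.
move=> [n [e [We span]]].
have /choice[b bP] : forall i, exists b, represents (e i) b.
  by move=> i; have [_] := We i.
have comb (a : 'I_n -> R[i]) (s : seq 'I_n) :
    represents (\sum_(i <- s) a i *: e i) (fun m => \sum_(i <- s) a i * b i m).
  elim: s => [|i s IH].
    rewrite big_nil (_ : (fun _ => _) = fun=> 0); first exact: represents0.
    by apply/funext => m; rewrite big_nil.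
  rewrite big_cons (_ : (fun _ => _) =
      fun m => a i * b i m + \sum_(j <- s) a j * b j m).
    exact: representsDZ.
  by apply/funext => m; rewrite big_cons.
have /choice[f fP] : forall m : 'I_n.+1, exists a : 'I_n -> R[i],
    forall k : 'I_n.+1, (m == k)%:R = \sum_i a i * b i k.
  move=> m; have [u Wu um] := W_basis m; have [a ua] := span _ Wu.
  have ua' : represents u (fun k => \sum_i a i * b i k).
    by rewrite ua; exact: comb.
  by exists a => k; rewrite eq_sym; exact: (represents_inj k um ua' (proj1 Wu)).
have I_prod : 1%:M = (\matrix_(m < n.+1, i < n) f m i) *m
    (\matrix_(i < n, k < n.+1) b i k).
  apply/matrixP => m k; rewrite !mxE fP; apply: eq_bigr => i _.
  by rewrite !mxE.
have := mxrankM_maxl (\matrix_(m < n.+1, i < n) f m i)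
  (\matrix_(i < n, k < n.+1) b i k).
rewrite -I_prod mxrank1 => /leq_trans/(_ (rank_leq_col _)).
by rewrite ltnn.
Qed.

Lemma spaceable_pieces : spaceable V N (V `\` V1).
Proof.
exists W; split.
- exact: W_notin_V1.
- by move=> u [].
- exact: W_submod.
- exact: W_closed.
- exact: W_infinite.
Qed.

End SpaceableCore.

(** * Choice of the parameters and conclusion *)

(** The 2-adic valuation provides the infinite classes: [2 ^ m * 3 ^ j] has valuation [m] and
    exceeds [j]. *)
Lemma logn2_fiber m j : exists n, (j <= n)%N /\ logn 2 n.+1 = m.
Proof.
have gt0 : (0 < 2 ^ m * 3 ^ j)%N by rewrite muln_gt0 !expn_gt0.
exists (2 ^ m * 3 ^ j).-1; rewrite (ltn_predK gt0); split.
  rewrite -ltnS (ltn_predK gt0); apply: (leq_trans (ltn_expl j _)) => //.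
  by rewrite leq_pmull// expn_gt0.
by rewrite lognM ?expn_gt0// pfactorK// lognX muln0 addn0.
Qed.

(** Failure of [weaker] at the constant [a] yields such [x] beyond any threshold. Past [M] the
    values of [Phi2] are at least [K], and [1 <= a] keeps [a * x] past [M]. *)
Lemma young_gap (R : realType) (Phi1 Phi2 : R -> R) (a K : R) :
  1 <= a -> young_function Phi2 -> ~ weaker Phi1 Phi2 ->
  exists x, [/\ 0 <= x, K <= Phi2 (a * x) & Phi2 (a * x) < Phi1 x].
Proof.
move=> a1 [_ _ _ _ /cvgryPge/(_ K)[M [_ MP]]] nw.
have [x] : exists x, Num.max 0 (M + 1) <= x /\ Phi2 (a * x) < Phi1 x.
  apply: contrapT => H; apply: nw; exists a, (Num.max 0 (M + 1)); split.
  - exact: lt_le_trans a1.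
  - by rewrite le_max lexx.
  - by move=> x xM; rewrite leNgt; apply/negP => lt; apply: H; exists x.
rewrite ge_max => -[/andP[x0 xM] lt]; exists x; split => //.
apply: MP; apply: (@lt_le_trans _ _ (M + 1)); first by rewrite ltrDl.
by apply: le_trans xM _; rewrite ler_peMl.
Qed.

Unset Implicit Arguments.

Theorem corollary3p7 (d : measure_display) (T : measurableType d) (R : realType)
  (mu : {sigma_finite_measure set T -> \bar R})
  (X : set (M0 mu)) (normX : M0 mu -> R) (Phi1 Phi2 : R -> R) (E : set T)
  (hX : banach_function_space X normX)
  (hPhi1 : young_function Phi1) (hPhi2 : young_function Phi2)
  (incrPhi1 : strictly_increasing_young Phi1)
  (incrPhi2 : strictly_increasing_young Phi2)
  (contPhi1 : continuous_young Phi1) (contPhi2 : continuous_young Phi2)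
  (hX1 : banach_function_space (orlicz X normX Phi1) (orlicz_norm X normX Phi1))
  (hX2 : banach_function_space (orlicz X normX Phi2) (orlicz_norm X normX Phi2))
  (mE : measurable E) (XE : X (chi mu E)) (muE : (0 < mu E)%E)
  (diffE : diffuse X normX E)
  (nweaker : ~ weaker Phi1 Phi2) :
  spaceable (orlicz X normX Phi2) (orlicz_norm X normX Phi2)
    (orlicz X normX Phi2 `\` orlicz X normX Phi1).
Proof.
have [nX _] := hX; have [nX1 _] := hX1; have [nX2 cX2] := hX2.
have e0 : 0 < normX (chi mu E).
  have [_ N_ge0 N_eq0 _ _] := nX; rewrite lt_neqAle N_ge0// andbT eq_sym.
  apply/eqP => /(N_eq0 _ XE)/(chi_eq0 mE) E0.
  by rewrite E0 ltxx in muE.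
(* The factor [2 ^+ n] makes the pieces summable for [Phi2]; [n.+1] makes their [Phi1] norms
   unbounded. *)
pose a n : R := n.+1%:R * 2 ^+ n.
have a1 n : 1 <= a n by rewrite mulr_ege1 ?exprn_ege1 ?ler1n.
(* The lower bound on [Phi2] gives the smallness that [diffuse_disjoint] requires of the
   inverses. *)
have /choice[x xP] : forall n, exists x, [/\ 0 <= x,
    2 ^+ n.+1 / normX (chi mu E) <= Phi2 (a n * x) & Phi2 (a n * x) < Phi1 x].
  by move=> n; exact: young_gap.
have Phi2_gt0 n : 0 < Phi2 (a n * x n).
  have [_ + _] := xP n; apply: lt_le_trans.
  by rewrite divr_gt0// exprn_gt0.
have [|A [mA tA XA NA]] := @diffuse_disjoint _ _ _ _ _ _ _
    (fun n => (Phi2 (a n * x n))^-1) nX diffE.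
  move=> n; rewrite invr_ge0 ltW//=; have [_ + _] := xP n.
  by rewrite -[X in _ -> _ <= X]invf_div lef_pV2 ?posrE// divr_gt0// exprn_gt0.
have [nu [nuE mnu]] := disjoint_index R mA tA.
pose c n := if n is k.+1 then k.+1%:R * x k else 0.
have pieceE n : index_class mu nu (fun k => if k == n.+1 then (c k)%:C%C else 0) =
    (n.+1%:R * x n)%:C%C *: chi mu (A n).
  apply: M0_ext; apply: filterS3
    (index_class_fun mu mnu (fun k => if k == n.+1 then (c k)%:C%C else 0))
    (M0_funZ (n.+1%:R * x n)%:C%C (chi mu (A n))) (chi_fun mu (mA n)) => t.
  move=> -> -> ->; rewrite indicE; case: eqP => [tn|tn].
    by rewrite tn mem_set ?mulr1//; exact/nuE.
  by rewrite memNset ?mulr0// => /nuE.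
apply: (@spaceable_pieces _ _ _ _ nu mnu _ _ _ _ nX2 cX2
  (orlicz_solid contPhi2 nX2) nX1 (orlicz_solid contPhi1 nX1) c erefl _ _
  (logn 2) logn2_fiber) => n; rewrite pieceE; have [x0 _ gap] := xP n.
  apply: orlicz_scaled_chi_le => //.
  - by rewrite mulr_ge0.
  (* For [l = 2^-n] the argument of [Phi2] is [a n * x n], so the product to bound is exactly 1. *)
  - by rewrite invrK mulrAC NA divff// gt_eqF// Phi2_gt0.
(* The factor [n.+1] leaves the norm by homogeneity; what remains has norm at least 1 since
   [Phi1 (x n)] exceeds [Phi2 (a n * x n)]. *)
move=> V1; rewrite rmorphM -scalerA.
have n0 : (n.+1%:R : R)%:C%C != 0 :> R[i] by rewrite eq_complex /= pnatr_eq0.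
have V1x : orlicz X normX Phi1 ((x n)%:C%C *: chi mu (A n)).
  have [sub _ _ _ _] := nX1; have := submodZ (n.+1%:R : R)%:C%C^-1 sub V1.
  by rewrite rmorphM scalerA mulrA mulVf// mul1r.
have [_ _ _ NZ _] := nX1; rewrite NZ// normc_real//.
rewrite ler_peMr//; apply: orlicz_scaled_chi_ge => //.
by rewrite NA ltr_pdivlMr// mul1r.
Qed.
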